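(* Assume constant returns to scale and let $(\mathbf{x}_o,\mathbf{y}_o)$ be one of the DMUs. Let the orientation satisfy $d^-_i=d^-$ for $i=1,\ldots,m$ and $d^+_r=d^+$ for $r=1,\ldots,s$, with constants $d^-,d^+>0$. Let $\beta^*_{\mathrm{L}}$ and $\beta^*_{\mathrm{Q}}$ be the optimal values of the linear oriented (LO) and quadratic-CRS oriented (QO) models evaluating $(\mathbf{x}_o,\mathbf{y}_o)$ with this orientation. Then $$\beta^*_{\mathrm{Q}}=\frac{d^-+d^+-\sqrt{(d^-+d^+)^2-\dfrac{4\beta^*_{\mathrm{L}}d^-d^+(d^-+d^+)}{1+\beta^*_{\mathrm{L}}d^+}}}{2d^-d^+},$$ and the target of the QO model is $(\theta^*_{\mathrm{Q}}\mathbf{x}_o,\phi^*_{\mathrm{Q}}\mathbf{y}_o)$ with $\theta^*_{\mathrm{Q}}=1-\beta^*_{\mathrm{Q}}d^-$ and $\phi^*_{\mathrm{Q}}=1/(1-\beta^*_{\mathrm{Q}}d^+)$.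
   Context: Fix positive integers $m,s,n$ and strictly positive data matrices $X\in\mathbb{R}_{>0}^{m\times n}$, $Y\in\mathbb{R}_{>0}^{s\times n}$, whose $j$-th columns $(\mathbf{x}_j,\mathbf{y}_j)$ are the inputs and outputs of the $j$-th decision-making unit (DMU). Inequalities between vectors are component-wise. The production possibility set under constant returns to scale is $$P=\{(\mathbf{x},\mathbf{y})\in\mathbb{R}_{>0}^{m+s} : X\boldsymbol{\lambda}\le \mathbf{x},\ \mathbf{y}\le Y\boldsymbol{\lambda}\text{ for some }\boldsymbol{\lambda}\in\mathbb{R}^n,\ \boldsymbol{\lambda}\ge\mathbf{0}\}.$$ An orientation is a pair $(\mathbf{d}^-,\mathbf{d}^+)\ne\mathbf{0}$ of non-negative vectors in $\mathbb{R}^m$ and $\mathbb{R}^s$. Given a DMU $(\mathbf{x}_o,\mathbf{y}_o)$: LO model: $\beta^*_{\mathrm{L}}$ is the maximum of $\beta\ge0$ such that $(\mathrm{diag}(\boldsymbol\theta)\mathbf{x}_o,\mathrm{diag}(\boldsymbol\phi)\mathbf{y}_o)\in P$ with $\theta_i=1-\beta d^-_i$ and $\phi_r=1+\beta d^+_r$. QO model: $\beta^*_{\mathrm{Q}}$ is the maximum of $\beta\ge0$ such that $(\mathrm{diag}(\boldsymbol\theta)\mathbf{x}_o,\mathrm{diag}(\boldsymbol\phi)\mathbf{y}_o)\in P$ with $\theta_i=1-\beta d^-_i$ and $\phi_r=1/(1-\beta d^+_r)$ (note that $P$ contains only strictly positive vectors, so $\beta d_r^+<1$). The target of a model is the activity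 $(\mathrm{diag}(\boldsymbol\theta^* )\mathbf{x}_o,\mathrm{diag}(\boldsymbol\phi^* )\mathbf{y}_o)$, where $\boldsymbol\theta^*,\boldsymbol\phi^*$ are the values of $\boldsymbol\theta,\boldsymbol\phi$ at the optimal $\beta$. *)

(* Defs.v *)
From mathcomp Require Import all_boot all_order all_algebra.
From mathcomp Require Import classical_sets reals.

Set Implicit Arguments.
Unset Strict Implicit.
Unset Printing Implicit Defensive.

Import Order.TTheory GRing.Theory Num.Theory.
Local Open Scope classical_set_scope.
Local Open Scope ring_scope.

Section DEA.
Variable R : realType.

Definition mx_pos (p q : nat) (A : 'M[R]_(p, q)) : Prop :=
  forall i j, 0 < A i j.

Definition mx_le (p q : nat) (A B : 'M[R]_(p, q)) : Prop :=
  forall i j, A i j <= B i j.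

Variables m s n : nat.

(* The production possibility set under constant returns to scale; as in the
   model, it only contains strictly positive activities. *)
Definition pps (X : 'M[R]_(m, n)) (Y : 'M[R]_(s, n)) :
    set ('cV[R]_m * 'cV[R]_s) :=
  [set a | [/\ mx_pos a.1, mx_pos a.2 &
     exists lambda : 'cV[R]_n,
       [/\ mx_le 0 lambda, mx_le (X *m lambda) a.1 &
           mx_le a.2 (Y *m lambda)]]].

Definition orientation (dm : 'cV[R]_m) (dp : 'cV[R]_s) : Prop :=
  [/\ mx_le 0 dm, mx_le 0 dp & (dm, dp) <> (0, 0)].

(* (diag(theta) x, diag(phi) y); [diag_mx] takes a row vector. *)
Definition scaled_activity (theta : 'cV[R]_m) (phi : 'cV[R]_s)
    (x : 'cV[R]_m) (y : 'cV[R]_s) : 'cV[R]_m * 'cV[R]_s :=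
  (diag_mx theta^T *m x, diag_mx phi^T *m y).

Definition LO_theta (dm : 'cV[R]_m) (beta : R) : 'cV[R]_m :=
  \col_i (1 - beta * dm i 0).

Definition LO_phi (dp : 'cV[R]_s) (beta : R) : 'cV[R]_s :=
  \col_r (1 + beta * dp r 0).

Definition QO_theta (dm : 'cV[R]_m) (beta : R) : 'cV[R]_m :=
  \col_i (1 - beta * dm i 0).

(* When beta * dp r 0 = 1 the r-th component is 1 / 0 = 0, and when
   beta * dp r 0 > 1 it is negative; for y > 0 the strict positivity required
   in [pps] then makes such a beta infeasible. *)
Definition QO_phi (dp : 'cV[R]_s) (beta : R) : 'cV[R]_s :=
  \col_r (1 / (1 - beta * dp r 0)).

Definition LO_activity dm dp x y (beta : R) :=
  scaled_activity (LO_theta dm beta) (LO_phi dp beta) x y.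

Definition QO_activity dm dp x y (beta : R) :=
  scaled_activity (QO_theta dm beta) (QO_phi dp beta) x y.

Definition LO_feasible X Y dm dp x y : set R :=
  [set beta | 0 <= beta /\ pps X Y (LO_activity dm dp x y beta)].

Definition QO_feasible X Y dm dp x y : set R :=
  [set beta | 0 <= beta /\ pps X Y (QO_activity dm dp x y beta)].

Definition is_maximum (A : set R) (b : R) : Prop := A b /\ ubound A b.

Definition LO_optimal X Y dm dp x y (beta : R) : Prop :=
  is_maximum (LO_feasible X Y dm dp x y) beta.

Definition QO_optimal X Y dm dp x y (beta : R) : Prop :=
  is_maximum (QO_feasible X Y dm dp x y) beta.

(* [a] is the target of the QO model: the activity at its optimal value. *)
Definition QO_target X Y dm dp x y (a : 'cV[R]_m * 'cV[R]_s) : Prop :=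
  exists2 beta : R, QO_optimal X Y dm dp x y beta &
    a = QO_activity dm dp x y beta.

End DEA.

(* Main.v *)
Require Import Defs.
From mathcomp Require Import all_boot all_order all_algebra.
From mathcomp Require Import classical_sets reals ring lra.

Set Implicit Arguments.
Unset Strict Implicit.
Unset Printing Implicit Defensive.

Import Order.TTheory GRing.Theory Num.Theory.
Local Open Scope ring_scope.

(** Under constant returns to scale the production possibility set is a cone,
so for a uniform orientation the feasibility of [(u x, v y)] with [u, v > 0]
depends only on the ratio [v / u] ([pps_same_ratio]).  In the LO model this
ratio is [(1 + beta dp) / (1 - beta dm)], in the QO model it is
[1 / ((1 - beta dm) (1 - beta dp))]; both increase continuously from 1 to
infinity, so at the two optima they take the same, largest feasible, value.
Equating the inverse ratios gives

  [(1 - betaQ dm) (1 - betaQ dp) = (1 - betaL dm) / (1 + betaL dp)],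

a quadratic equation in [betaQ] of which the stated formula is the smaller
root; positivity of both factors on the left excludes the larger one.

Both ratios have explicit inverses: [QO_parameter_spec] gives the QO parameter
with the ratio of a feasible LO parameter, and [QO_feasible_ratio] the LO
parameter with the ratio of a feasible QO parameter, which the optimality of
[betaL] then bounds. *)

(** * Activities with uniform contraction and expansion *)

Section UniformOrientation.
Variables (R : realType) (m s n : nat).
Variables (X : 'M[R]_(m, n)) (Y : 'M[R]_(s, n)).

Lemma pps_cone (t : R) (x : 'cV[R]_m) (y : 'cV[R]_s) :
  0 < t -> pps X Y (x, y) -> pps X Y (t *: x, t *: y).
Proof.
move=> t_gt0 [/= x_gt0 y_gt0 [l [l_ge0 Xl lY]]]; split=> /=.
- by move=> i j; rewrite mxE mulr_gt0.
- by move=> i j; rewrite mxE mulr_gt0.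
exists (t *: l); split=> i j; rewrite -?scalemxAr.
- by rewrite !mxE mulr_ge0 ?(ltW t_gt0) //; have := l_ge0 i j; rewrite mxE.
- by rewrite [leLHS]mxE [leRHS]mxE ler_pM2l.
- by rewrite [leLHS]mxE [leRHS]mxE ler_pM2l.
Qed.

Lemma pps_same_ratio (u v u' v' : R) (x : 'cV[R]_m) (y : 'cV[R]_s) :
  0 < u -> 0 < u' -> v * u' = v' * u ->
  pps X Y (u *: x, v *: y) -> pps X Y (u' *: x, v' *: y).
Proof.
move=> u_gt0 u'_gt0 ratio.
have u_neq0 : u != 0 by rewrite gt_eqF.
have -> : u' = u' / u * u by rewrite divfK.
have -> : v' = u' / u * v by rewrite mulrAC [u' * v]mulrC ratio mulfK.
by rewrite -!(scalerA (u' / u)); apply: pps_cone; rewrite divr_gt0.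
Qed.

Lemma pps_scale_gt0 (m_gt0 : (0 < m)%N) (s_gt0 : (0 < s)%N) (u v : R)
    (x : 'cV[R]_m) (y : 'cV[R]_s) (x_pos : mx_pos x) (y_pos : mx_pos y) :
  pps X Y (u *: x, v *: y) -> 0 < u /\ 0 < v.
Proof.
move=> [/= ux_gt0 vy_gt0 _]; split.
- by have := ux_gt0 (Ordinal m_gt0) 0; rewrite mxE pmulr_lgt0.
- by have := vy_gt0 (Ordinal s_gt0) 0; rewrite mxE pmulr_lgt0.
Qed.

Lemma scaled_activity_const (theta : 'cV[R]_m) (phi : 'cV[R]_s) (u v : R)
    (x : 'cV[R]_m) (y : 'cV[R]_s) :
  (forall i, theta i 0 = u) -> (forall r, phi r 0 = v) ->
  scaled_activity theta phi x y = (u *: x, v *: y).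
Proof.
by move=> thetaE phiE; rewrite /scaled_activity; congr pair;
  apply/matrixP => i j; rewrite mul_diag_mx !mxE ?thetaE ?phiE.
Qed.

Variables (dvm : 'cV[R]_m) (dvp : 'cV[R]_s) (dm dp : R).
Hypotheses (dvmE : forall i, dvm i 0 = dm) (dvpE : forall r, dvp r 0 = dp).

Lemma LO_activity_const (x : 'cV[R]_m) (y : 'cV[R]_s) (beta : R) :
  LO_activity dvm dvp x y beta
    = ((1 - beta * dm) *: x, (1 + beta * dp) *: y).
Proof.
by apply: scaled_activity_const => i; rewrite mxE ?dvmE ?dvpE.
Qed.

Lemma QO_activity_const (x : 'cV[R]_m) (y : 'cV[R]_s) (beta : R) :
  QO_activity dvm dvp x y beta
    = ((1 - beta * dm) *: x, (1 / (1 - beta * dp)) *: y).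
Proof.
by apply: scaled_activity_const => i; rewrite mxE ?dvmE ?dvpE.
Qed.

Hypotheses (m_gt0 : (0 < m)%N) (s_gt0 : (0 < s)%N).
Variables (x : 'cV[R]_m) (y : 'cV[R]_s).
Hypotheses (x_pos : mx_pos x) (y_pos : mx_pos y).

Lemma LO_feasible_contraction_gt0 (beta : R) :
  LO_feasible X Y dvm dvp x y beta -> 0 < 1 - beta * dm.
Proof.
by move=> [_]; rewrite LO_activity_const => /(pps_scale_gt0 m_gt0 s_gt0)[].
Qed.

Lemma QO_feasible_factors_gt0 (beta : R) :
  QO_feasible X Y dvm dvp x y beta ->
  0 < 1 - beta * dm /\ 0 < 1 - beta * dp.
Proof.
move=> [_]; rewrite QO_activity_const => /(pps_scale_gt0 m_gt0 s_gt0)[] //.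
by move=> ? ; rewrite div1r invr_gt0.
Qed.

(** * The LO and QO optima share the same ratio *)

Hypotheses (dm_gt0 : 0 < dm) (dp_gt0 : 0 < dp).

(** With [k = (1 - beta dm) (1 - beta dp)] the inverse of the QO ratio, the LO
parameter of ratio [1 / k] is [(1 - k) / (k dp + dm)]; the conclusion is the
inequality between this parameter and the LO optimum, cleared of
denominators. *)
Lemma QO_feasible_ratio (betaL beta : R) :
  LO_optimal X Y dvm dvp x y betaL -> QO_feasible X Y dvm dvp x y beta ->
  1 - betaL * dm <= (1 - beta * dm) * (1 - beta * dp) * (1 + betaL * dp).
Proof.
move=> [_ ubL] feas; have [t_gt0 p_gt0] := QO_feasible_factors_gt0 feas.
case: feas => beta_ge0; rewrite QO_activity_const => feas.
set k := (1 - beta * dm) * (1 - beta * dp).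
have k_gt0 : 0 < k by exact: mulr_gt0.
have bdm : 0 <= beta * dm by rewrite mulr_ge0 // ltW.
have bdp : 0 <= beta * dp by rewrite mulr_ge0 // ltW.
have k_le1 : k <= 1 by rewrite /k mulr_ile1 //; lra.
have den_gt0 : 0 < k * dp + dm by rewrite addr_gt0 // mulr_gt0.
have den_neq0 : k * dp + dm != 0 by rewrite gt_eqF.
pose b := (1 - k) / (k * dp + dm).
have uE : 1 - b * dm = k * (dp + dm) / (k * dp + dm) by rewrite /b; field.
have vE : 1 + b * dp = (dp + dm) / (k * dp + dm) by rewrite /b; field.
have : b <= betaL.
  apply: ubL; split; first by rewrite /b divr_ge0 ?subr_ge0 // ltW.
  rewrite LO_activity_const; apply: pps_same_ratio feas => //.
    by rewrite uE divr_gt0 // mulr_gt0 // addr_gt0.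
  by rewrite uE vE /k; field; rewrite den_neq0 gt_eqF.
rewrite /b ler_pdivrMr //; nra.
Qed.

(** The smaller root of
[(1 - beta dm) (1 - beta dp) = (1 - betaL dm) / (1 + betaL dp)]. *)
Definition QO_parameter (betaL : R) : R :=
  (dm + dp
     - Num.sqrt ((dm + dp) ^+ 2
         - 4 * betaL * dm * dp * (dm + dp) / (1 + betaL * dp)))
    / (2 * dm * dp).

(** The quadratic is [dm dp beta^2 - (dm + dp) beta + c = 0], where
[c = betaL (dm + dp) / (1 + betaL dp)] satisfies [0 <= c < 1].  Hence its
discriminant exceeds [(dm - dp)^2], which puts the smaller root below both
[1 / dm] and [1 / dp], and is at most [(dm + dp)^2], which makes it
nonnegative. *)
Lemma QO_parameter_spec (betaL : R) (beta := QO_parameter betaL) :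
  0 <= betaL -> 0 < 1 - betaL * dm ->
  [/\ 0 <= beta, 0 < 1 - beta * dm, 0 < 1 - beta * dp &
      (1 - beta * dm) * (1 - beta * dp) * (1 + betaL * dp) = 1 - betaL * dm].
Proof.
move=> bL_ge0 uL_gt0; rewrite /beta /QO_parameter.
have vL_gt0 : 0 < 1 + betaL * dp by rewrite ltr_wpDr // mulr_ge0 // ltW.
have vL_neq0 : 1 + betaL * dp != 0 by rewrite gt_eqF.
pose c := betaL * (dm + dp) / (1 + betaL * dp).
have c_ge0 : 0 <= c by rewrite divr_ge0 ?(ltW vL_gt0) // mulr_ge0 // ltW // addr_gt0.
have c_lt1 : c < 1 by rewrite ltr_pdivrMr //; lra.
have cE : (1 - c) * (1 + betaL * dp) = 1 - betaL * dm by rewrite /c; field.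
have -> : 4 * betaL * dm * dp * (dm + dp) / (1 + betaL * dp) = 4 * (dm * dp) * c.
  by rewrite /c; field.
have dmp_gt0 : 0 < dm * dp by rewrite mulr_gt0.
have dmpc_ge0 : 0 <= dm * dp * c by rewrite mulr_ge0 // ltW.
have dmpc_lt : dm * dp * c < dm * dp by rewrite gtr_pMr.
set D := _ - 4 * (dm * dp) * c.
have D_gt : (dm - dp) ^+ 2 < D by rewrite /D; nra.
have D_le : D <= (dm + dp) ^+ 2 by rewrite /D; lra.
have D_ge0 : 0 <= D by rewrite (le_trans (sqr_ge0 _) (ltW D_gt)).
set q := Num.sqrt D.
have qE : q ^+ 2 = D by rewrite sqr_sqrtr.
have q_ge0 : 0 <= q by exact: sqrtr_ge0.
have q_le : q <= dm + dp.
  by rewrite -(@ler_pXn2r _ 2) ?nnegrE ?qE // addr_ge0 // ltW.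
have q_gt : `|dm - dp| < q.
  by rewrite -(@ltr_pXn2r _ 2) ?nnegrE ?normr_ge0 // qE real_normK ?num_real.
have [q_gtm q_gtp] : dm - dp < q /\ dp - dm < q.
  by move: q_gt; rewrite ltr_norml => /andP[? ?]; split; lra.
have [dm_neq0 dp_neq0] : dm != 0 /\ dp != 0 by rewrite !gt_eqF.
have uE : 1 - (dm + dp - q) / (2 * dm * dp) * dm = (dp - dm + q) / (2 * dp).
  by field; rewrite dm_neq0 dp_neq0.
have vE : 1 - (dm + dp - q) / (2 * dm * dp) * dp = (dm - dp + q) / (2 * dm).
  by field; rewrite dm_neq0 dp_neq0.
split.
- by rewrite divr_ge0 ?subr_ge0 // ?mulr_ge0 // ltW.
- by rewrite uE divr_gt0 ?mulr_gt0 //; lra.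
- by rewrite vE divr_gt0 ?mulr_gt0 //; lra.
rewrite uE vE -cE; congr (_ * _).
have -> : (dp - dm + q) / (2 * dp) * ((dm - dp + q) / (2 * dm))
    = (q ^+ 2 - (dm - dp) ^+ 2) / (4 * (dm * dp)).
  by field; rewrite dm_neq0 dp_neq0.
by rewrite qE /D; field; rewrite dm_neq0 dp_neq0.
Qed.

Lemma QO_parameter_feasible (betaL : R) :
  LO_feasible X Y dvm dvp x y betaL ->
  QO_feasible X Y dvm dvp x y (QO_parameter betaL).
Proof.
move=> feas; have uL_gt0 := LO_feasible_contraction_gt0 feas.
case: feas => bL_ge0; rewrite LO_activity_const => feas.
have [b_ge0 u_gt0 v_gt0 ratio] := QO_parameter_spec bL_ge0 uL_gt0.
split=> //; rewrite QO_activity_const; apply: pps_same_ratio feas => //.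
by rewrite -ratio; field; rewrite gt_eqF.
Qed.

Lemma QO_optimal_value (betaL betaQ : R) :
  LO_optimal X Y dvm dvp x y betaL -> QO_optimal X Y dvm dvp x y betaQ ->
  betaQ = QO_parameter betaL.
Proof.
move=> optL [feasQ ubQ]; have [feasL _] := optL.
have uL_gt0 := LO_feasible_contraction_gt0 feasL.
have [bL_ge0 _] := feasL.
have [b_ge0 u_gt0 v_gt0 ratio] := QO_parameter_spec bL_ge0 uL_gt0.
have [uQ_gt0 vQ_gt0] := QO_feasible_factors_gt0 feasQ.
have vL_gt0 : 0 < 1 + betaL * dp by rewrite ltr_wpDr // mulr_ge0 // ltW.
apply/eqP; rewrite eq_le (ubQ _ (QO_parameter_feasible feasL)) andbT.
(* The product (1 - beta dm) (1 - beta dp) strictly decreases where both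
   factors are positive, so a larger betaQ would have too large a ratio. *)
rewrite leNgt; apply/negP => lt_b.
have := QO_feasible_ratio optL feasQ; rewrite -ratio ler_pM2r // leNgt.
by case/negP; apply: ltr_pM; rewrite ?(ltW uQ_gt0) ?(ltW vQ_gt0) // ltrD2l
  ltrN2 ltr_pM2r.
Qed.

End UniformOrientation.

Lemma is_maximum_unique (R : realType) (A : set R) (b c : R) :
  is_maximum A b -> is_maximum A c -> b = c.
Proof.
by move=> [Ab ubb] [Ac ubc]; apply/eqP; rewrite eq_le (ubb _ Ac) (ubc _ Ab).
Qed.

Theorem mainTheorem3 (R : realType) (m s n : nat)
    (m_gt0 : (0 < m)%N) (s_gt0 : (0 < s)%N) (n_gt0 : (0 < n)%N)
    (X : 'M[R]_(m, n)) (Y : 'M[R]_(s, n))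
    (X_pos : mx_pos X) (Y_pos : mx_pos Y)
    (o : 'I_n)
    (dvm : 'cV[R]_m) (dvp : 'cV[R]_s) (dv_orient : orientation dvm dvp)
    (dm dp : R) (dm_gt0 : 0 < dm) (dp_gt0 : 0 < dp)
    (dvmE : forall i, dvm i 0 = dm) (dvpE : forall r, dvp r 0 = dp)
    (betaL betaQ : R)
    (betaL_opt : LO_optimal X Y dvm dvp (col o X) (col o Y) betaL)
    (betaQ_opt : QO_optimal X Y dvm dvp (col o X) (col o Y) betaQ) :
  betaQ = (dm + dp
           - Num.sqrt ((dm + dp) ^+ 2
               - 4 * betaL * dm * dp * (dm + dp) / (1 + betaL * dp)))
          / (2 * dm * dp)
  /\ forall a : 'cV[R]_m * 'cV[R]_s,
       QO_target X Y dvm dvp (col o X) (col o Y) a <->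
       a = ((1 - betaQ * dm) *: col o X, (1 / (1 - betaQ * dp)) *: col o Y).
Proof.
have x_pos : mx_pos (col o X) by move=> i j; rewrite mxE.
have y_pos : mx_pos (col o Y) by move=> i j; rewrite mxE.
split; first exact: (QO_optimal_value dvmE dvpE m_gt0 s_gt0 x_pos y_pos
  dm_gt0 dp_gt0 betaL_opt betaQ_opt).
move=> a; rewrite -(QO_activity_const dvmE dvpE); split.
  by case=> beta beta_opt ->; rewrite (is_maximum_unique beta_opt betaQ_opt).
by move=> ->; exists betaQ.
Qed.
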